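(* Let $a,b,c\in\mathbf{Z}$ and $d=b^2-4ac$. Let $p$ be an odd prime and let $i\in\mathbf{Z}$, $i\geq 2$. If $\gcd(a,p^i)=p^l$ with $1\leq l<i$, then IQF is valid for $ax^2+bx+c\equiv 0\bmod p^i$ if and only if either (a) $d$ is a quadratic non-residue of $p^i$, or (b) $d$ is a quadratic residue of $p^i$ and exactly one of the following mutually exclusive conditions holds: (i) $l>1$, $b$ is divisible by $p$, and $(p^i,p^l)$ forms a $(b,d)$-obstruction; (ii) $l=1$, $i$ is odd, $b$ and $c$ are divisible by $p$, and $d$ is divisible by $p^{i+1}$.
   Context: IQF (the intermediate form of the quadratic formula) is valid for $ax^2+bx+c\equiv 0\bmod n$, with $d=b^2-4ac$, if for every integer $x$: $ax^2+bx+c\equiv 0\bmod n$ if and only if there is an integer $s$ with $s^2\equiv d\bmod n$ and $2ax\equiv -b+s\bmod n$. An integer $u$ is a quadratic residue of a positive integer $v$ if $x^2\equiv u\bmod v$ has an integer solution (no coprimality is required), and a quadratic non-residue of $v$ otherwise. The multiplicity of a prime $p$ in a nonzero integer $z$ is the largest $e\geq 0$ with $p^e\mid z$. $(b,d)$-obstruction: let $p$ be a prime, $\alpha,\beta$ positive integers, $b,d$ integers. The pair $(p^{\alpha},p^{\beta})$ forms a $(b,d)$-obstruction if one of the following holds: (1) $d$ is not divisible by $p^{\alpha}$, the multiplicity of $p$ in $d$ is even, say $2\mu$, and, writing $d=d_1p^{2\mu}$ and letting $\Sigma$ be the set of all solutions $\sigma$, $0\leq\sigma<p^{\alpha-2\mu}$,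 of $x^2\equiv d_1\bmod p^{\alpha-2\mu}$, one has $\sigma p^{\mu}+jp^{\alpha-\mu}\not\equiv b\bmod p^{\beta}$ for all $\sigma\in\Sigma$ and all $j\in\{0,1,\dots,p^{\mu}-1\}$; (2) $d$ is divisible by $p^{\alpha}$ and, with $s$ chosen so that $\alpha=2s$ if $\alpha$ is even and $\alpha=2s-1$ if $\alpha$ is odd, one has $jp^{s}\not\equiv b\bmod p^{\beta}$ for all $j\in\{0,1,\dots,p^{\alpha-s}-1\}$. *)

(* Defs.v *)
From mathcomp Require Import all_boot all_order all_algebra.

Set Implicit Arguments.
Unset Strict Implicit.
Unset Printing Implicit Defensive.

Import Order.TTheory GRing.Theory Num.Theory.
Local Open Scope ring_scope.

Definition IQF_valid (a b c n : int) : Prop :=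
  forall x : int,
    (a * x ^+ 2 + b * x + c = 0 %[mod n])%Z <->
    exists s : int,
      (s ^+ 2 = b ^+ 2 - 4 * a * c %[mod n])%Z /\
      (2 * a * x = - b + s %[mod n])%Z.

(* No coprimality of u and v is required. *)
Definition quadratic_residue (u v : int) : Prop :=
  exists x : int, (x ^+ 2 = u %[mod v])%Z.

Definition quadratic_nonresidue (u v : int) : Prop :=
  ~ quadratic_residue u v.

(* Case p ^ alpha does not divide d.  Then d is nonzero, so logn p `|d| is the
   multiplicity of p in d, and mu.*2 < alpha, so the truncated subtractions are
   exact. *)
Definition obstruction_ndvd (p alpha beta : nat) (b d : int) : Prop :=
  ~ (p%:Z ^+ alpha %| d)%Z /\
  exists (mu : nat) (d1 : int),
    [/\ logn p `|d|%N = mu.*2,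
        d = d1 * p%:Z ^+ mu.*2
      & forall sigma j : nat,
          (sigma < p ^ (alpha - mu.*2))%N ->
          (sigma%:Z ^+ 2 = d1 %[mod p%:Z ^+ (alpha - mu.*2)])%Z ->
          (j < p ^ mu)%N ->
          ~ (sigma%:Z * p%:Z ^+ mu + j%:Z * p%:Z ^+ (alpha - mu) = b
               %[mod p%:Z ^+ beta])%Z].

Definition obstruction_dvd (p alpha beta : nat) (b d : int) : Prop :=
  (p%:Z ^+ alpha %| d)%Z /\
  exists s : nat,
    (if odd alpha then alpha = (s.*2 - 1)%N else alpha = s.*2) /\
    forall j : nat,
      (j < p ^ (alpha - s))%N ->
      ~ (j%:Z * p%:Z ^+ s = b %[mod p%:Z ^+ beta])%Z.

(* (p ^ alpha, p ^ beta) forms a (b, d)-obstruction; meaningful for p prime and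
   alpha, beta positive. *)
Definition obstruction (p alpha beta : nat) (b d : int) : Prop :=
  obstruction_ndvd p alpha beta b d \/ obstruction_dvd p alpha beta b d.

Definition exactly_one (P Q : Prop) : Prop := (P /\ ~ Q) \/ (~ P /\ Q).

(* Main.v *)
(* With f(x) = a x^2 + b x + c one has (2 a x + b)^2 - d = 4 a f(x), so IQF is
   valid iff every root of f modulo p^(i - l) is already a root modulo p^i.
   Roots of f modulo p^(i - l) correspond to square roots s of d modulo p^i with
   s = b mod p^l; when d is a residue, the obstruction says that there are none.
   If a root x exists and IQF is valid, comparing f(x) with f(x + p^k) and
   f(x - p^k) for the least k keeping these roots modulo p^(i - l) forces l = 1,
   i = 2 k + 1 and p^(k + 1) | 2 a x + b, which is case (ii).  If p does not
   divide b, a root always exists by Hensel lifting, and the last divisibility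
   fails. *)

Require Import Defs.
From mathcomp Require Import all_boot all_order all_algebra.
From mathcomp Require Import ring zify.
From Stdlib Require Import Classical.

Import Order.TTheory GRing.Theory Num.Theory.
Local Open Scope ring_scope.

(** * Divisibility by powers of a prime *)

Lemma eqmodz_dvd (m n k : int) : (m = n %[mod k])%Z <-> (k %| m - n)%Z.
Proof. by rewrite -eqz_mod_dvd; split=> /eqP. Qed.

Lemma dvdz_addr (k m n : int) : (k %| m)%Z -> (k %| m + n)%Z = (k %| n)%Z.
Proof. by move=> km; rewrite !/(dvdz _ _) rpredDl. Qed.

Section PrimePowers.

Variable p : nat.
Hypothesis p_prime : prime p.

Lemma primez_exp_neq0 n : p%:Z ^+ n != 0.
Proof. by rewrite expf_neq0 // -lt0n prime_gt0. Qed.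

Lemma primez_coprime m : coprimez p%:Z m = ~~ (p%:Z %| m)%Z.
Proof. by rewrite coprimezE prime_coprime. Qed.

Lemma dvdz_primeM m n : (p%:Z %| m * n)%Z = (p%:Z %| m)%Z || (p%:Z %| n)%Z.
Proof. by rewrite !dvdzE abszM Euclid_dvdM. Qed.

Lemma primez_dvd_exp m n : (p%:Z ^+ m %| p%:Z ^+ n)%Z = (m <= n)%N.
Proof. by rewrite dvdz_Pexp2l // ltz_nat prime_gt1. Qed.

Lemma dvdz_primeX_logn n (z : int) :
  z != 0 -> (p%:Z ^+ n %| z)%Z = (n <= logn p `|z|)%N.
Proof. by move=> z0; rewrite dvdzE abszX pfactor_dvdn // absz_gt0. Qed.

(** The multiplicity of p in z^2 is twice that in z, and [uphalf] rounds n / 2 up. *)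
Lemma dvdz_primeX_sqr n (z : int) :
  (p%:Z ^+ n %| z ^+ 2)%Z = (p%:Z ^+ uphalf n %| z)%Z.
Proof.
have [->|z0] := eqVneq z 0; first by rewrite expr0n !dvdz0.
rewrite !dvdz_primeX_logn ?expf_neq0 // abszX lognX.
by rewrite mul2n leq_uphalf_double.
Qed.

Lemma dvdz_primeXD m n z :
  (p%:Z ^+ (m + n) %| p%:Z ^+ m * z)%Z = (p%:Z ^+ n %| z)%Z.
Proof. by rewrite exprD dvdz_mul2l // primez_exp_neq0. Qed.

Lemma primeX_linear_congruence (u t : int) n : ~~ (p%:Z %| u)%Z ->
  exists x, (p%:Z ^+ n %| u * x - t)%Z.
Proof.
rewrite -primez_coprime => /(coprimezXl n)/coprimezP[[v w] /= vw].
exists (t * w); apply/dvdzP; exists (- (t * v)).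
by rewrite -[t in _ - t]mulr1 -vw; ring.
Qed.

Lemma odd_prime_ndvdz2X n : odd p -> ~~ (p%:Z %| 2 ^+ n)%Z.
Proof.
move=> p_odd; rewrite -primez_coprime coprimezXr // primez_coprime dvdzE /=.
by rewrite dvdn_prime2 //; apply/eqP => p2; rewrite p2 in p_odd.
Qed.

(** As l < i, p^(l + 1) divides p^i, so one more factor p in a would enlarge the gcd. *)
Lemma gcdz_primeX_eq a i l : (l < i)%N -> gcdz a (p%:Z ^+ i) = p%:Z ^+ l ->
  exists2 a', a = p%:Z ^+ l * a' & ~~ (p%:Z %| a')%Z.
Proof.
move=> li ga; have /dvdzP[a' a_def] : (p%:Z ^+ l %| a)%Z by rewrite -ga dvdz_gcdl.
rewrite mulrC in a_def; exists a' => //; apply/negP => pa'.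
have : (p%:Z ^+ l.+1 %| gcdz a (p%:Z ^+ i))%Z.
  by rewrite dvdz_gcd primez_dvd_exp li andbT a_def exprSr dvdz_mul2l ?primez_exp_neq0.
by rewrite ga primez_dvd_exp ltnn.
Qed.

(** * Square roots modulo prime powers and the obstruction *)

(** Supplies the bounded natural representatives over which the obstruction quantifies. *)
Lemma edivz_primeX n (z : int) :
  exists2 r : nat, (r < p ^ n)%N & exists k, z = r%:Z + k * p%:Z ^+ n.
Proof.
have q0 := primez_exp_neq0 n; exists (absz (z %% p%:Z ^+ n)%Z).
  rewrite -ltz_nat gez0_abs ?modz_ge0 // -[Posz (p ^ n)]natz natrX natz.
  by rewrite ltz_pmod ?exprn_gt0 ?ltz_nat ?prime_gt0.
exists (z %/ p%:Z ^+ n)%Z.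
by rewrite gez0_abs ?modz_ge0 // [LHS](divz_eq z (p%:Z ^+ n)) addrC.
Qed.

(* If p^i does not divide d = d1 p^(2 mu), a square root of d modulo p^i is p^mu
   times a square root of d1 modulo p^(i - 2 mu), and the latter is only
   determined modulo p^(i - mu). *)
Lemma sqrt_primeX_form i mu (d1 s : int) : (mu.*2 <= i)%N ->
  (p%:Z ^+ i %| s ^+ 2 - d1 * p%:Z ^+ mu.*2)%Z <->
  exists sigma j : nat,
    [/\ (sigma < p ^ (i - mu.*2))%N,
        (p%:Z ^+ (i - mu.*2) %| sigma%:Z ^+ 2 - d1)%Z,
        (j < p ^ mu)%N
      & (p%:Z ^+ i %| s - (sigma%:Z * p%:Z ^+ mu + j%:Z * p%:Z ^+ (i - mu)))%Z].
Proof.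
move=> mui; have [n i_def] : exists n, i = (mu.*2 + n)%N.
  by exists (i - mu.*2)%N; rewrite subnKC.
have -> : (i - mu.*2 = n)%N by lia.
have -> : (i - mu = n + mu)%N by lia.
rewrite {}i_def => {mui i}.
have EM : p%:Z ^+ mu.*2 = p%:Z ^+ mu * p%:Z ^+ mu by rewrite -addnn exprD.
have EN : p%:Z ^+ (mu.*2 + n) = p%:Z ^+ mu * p%:Z ^+ mu * p%:Z ^+ n.
  by rewrite exprD EM.
split=> [ps|[sigma [j [_ ps _ /dvdzP[k sk]]]]].
  have /dvdzP[t s_def] : (p%:Z ^+ mu %| s)%Z.
    have := dvdz_primeX_sqr mu.*2 s; rewrite uphalf_double => <-.
    rewrite -[s ^+ 2](subrK (d1 * p%:Z ^+ mu.*2)) dvdz_addr ?dvdz_mull //.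
    by apply: dvdz_trans ps; rewrite dvdz_exp2l ?leq_addr.
  have {}ps : (p%:Z ^+ n %| t ^+ 2 - d1)%Z.
    rewrite -(dvdz_primeXD mu.*2).
    suff -> : p%:Z ^+ mu.*2 * (t ^+ 2 - d1) = s ^+ 2 - d1 * p%:Z ^+ mu.*2 by [].
    by rewrite s_def EM; ring.
  (* With t = sigma + k p^n and k = j + h p^mu, multiplying by p^mu turns the h-term into a multiple
     of p^(2 mu + n). *)
  have [sigma sn [k t_def]] := edivz_primeX n t.
  have [j jm [h k_def]] := edivz_primeX mu k.
  exists sigma, j; split=> //.
    have -> : sigma%:Z ^+ 2 - d1 =
      - (k * (sigma%:Z + t)) * p%:Z ^+ n + (t ^+ 2 - d1) by rewrite t_def; ring.
    by rewrite dvdz_addr // dvdz_mull.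
  apply/dvdzP; exists h; rewrite s_def t_def k_def EN exprD; ring.
have -> : s ^+ 2 - d1 * p%:Z ^+ mu.*2 = p%:Z ^+ mu.*2 * (sigma%:Z ^+ 2 - d1)
   + (2 * sigma%:Z * j%:Z + 2 * sigma%:Z * k * p%:Z ^+ mu
      + (j%:Z + k * p%:Z ^+ mu) ^+ 2 * p%:Z ^+ n) * p%:Z ^+ (mu.*2 + n).
  rewrite -[s](subrK (sigma%:Z * p%:Z ^+ mu + j%:Z * p%:Z ^+ (n + mu))) sk.
  by rewrite EN EM !exprD; ring.
by rewrite addrC dvdz_addr ?dvdz_primeXD ?dvdz_mull //.
Qed.

(** The roots are multiples of p^(uphalf i); reducing the cofactor modulo p^(i - uphalf i) gives
    j. *)
Lemma sqrt0_primeX_form i (s : int) :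
  (p%:Z ^+ i %| s ^+ 2)%Z <->
  exists2 j : nat, (j < p ^ (i - uphalf i))%N &
    (p%:Z ^+ i %| s - j%:Z * p%:Z ^+ uphalf i)%Z.
Proof.
have EN : p%:Z ^+ i = p%:Z ^+ (i - uphalf i) * p%:Z ^+ uphalf i.
  by rewrite -exprD subnK //; lia.
rewrite dvdz_primeX_sqr; split=> [/dvdzP[t ->]|[j _ ps]].
  have [j ji [k ->]] := edivz_primeX (i - uphalf i) t.
  exists j => //; apply/dvdzP; exists k; rewrite EN; ring.
rewrite -[s](subrK (j%:Z * p%:Z ^+ uphalf i)) dvdz_addr ?dvdz_mull //.
by apply: dvdz_trans ps; rewrite dvdz_exp2l //; lia.
Qed.

(** If t^2 = d modulo p^i, then t^2 and d are divisible by the same p^n with n <= i; as p^i does not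
    divide d, their multiplicities agree, and that of t^2 is even. *)
Lemma residue_ndvd_logn i (d : int) :
  ~~ (p%:Z ^+ i %| d)%Z -> quadratic_residue d (p%:Z ^+ i) ->
  exists mu d1, [/\ logn p `|d|%N = mu.*2, d = d1 * p%:Z ^+ mu.*2 & (mu.*2 < i)%N].
Proof.
move=> pd [t /eqmodz_dvd td].
have d0 : d != 0 by apply: contraNneq pd => ->; rewrite dvdz0.
have li : (logn p `|d| < i)%N by rewrite ltnNge -dvdz_primeX_logn.
have low n : (n <= i)%N -> (p%:Z ^+ n %| t ^+ 2)%Z = (p%:Z ^+ n %| d)%Z.
  move=> ni; rewrite -[t ^+ 2](subrK d) dvdz_addr //.
  by apply: dvdz_trans td; rewrite dvdz_exp2l.
have t0 : t != 0.
  by apply: contraNneq pd => t0; rewrite -low // t0 expr0n dvdz0.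
have lt : logn p `|d| = (logn p `|t|).*2.
  rewrite -mul2n -lognX -abszX; apply/eqP; rewrite eqn_leq.
  rewrite -dvdz_primeX_logn ?expf_neq0 // low ?(ltnW li) // dvdz_primeX_logn //.
  rewrite leqnn /= leqNgt -dvdz_primeX_logn ?expf_neq0 // low //.
  by rewrite dvdz_primeX_logn // ltnn.
have /dvdzP[d1 d_def] : (p%:Z ^+ (logn p `|t|).*2 %| d)%Z.
  by rewrite dvdz_primeX_logn // lt.
by exists (logn p `|t|), d1; rewrite -lt; split=> //; rewrite lt.
Qed.

(** Both cases of the obstruction run through the square roots s of d modulo p^i, and since l <= i,
    the congruence s = b modulo p^l depends only on s modulo p^i. *)
Lemma obstructionP i l (b d : int) : (l <= i)%N ->
  quadratic_residue d (p%:Z ^+ i) ->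
  obstruction p i l b d <->
  ~ exists2 s, (p%:Z ^+ i %| s ^+ 2 - d)%Z & (p%:Z ^+ l %| s - b)%Z.
Proof.
move=> li res.
have cong (s u : int) : (p%:Z ^+ i %| s - u)%Z ->
    (p%:Z ^+ l %| s - b)%Z = (p%:Z ^+ l %| u - b)%Z.
  move=> su; have -> : s - b = (s - u) + (u - b) by ring.
  by rewrite dvdz_addr //; apply: dvdz_trans su; rewrite dvdz_exp2l.
have [pd|pd] := boolP (p%:Z ^+ i %| d)%Z.
  have sd s : (p%:Z ^+ i %| s ^+ 2 - d)%Z = (p%:Z ^+ i %| s ^+ 2)%Z.
    by rewrite addrC dvdz_addr // rpredN.
  (* Both parities give the exponent i / 2 rounded up. *)
  have half : if odd i then i = ((uphalf i).*2 - 1)%N else i = (uphalf i).*2.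
    by case: ifP; lia.
  split=> [[[/negP]|[_ [s [si obs]]] [t]]|no_root]; first by rewrite pd.
    have {}si : s = uphalf i by case: ifP si => _; lia.
    rewrite si in obs.
    rewrite sd => /sqrt0_primeX_form[j ji tj]; rewrite (cong _ _ tj) => jb.
    by apply: (obs j ji); apply/eqmodz_dvd.
  right; split=> //; exists (uphalf i); split=> // j ji /eqmodz_dvd jb.
  apply: no_root; exists (j%:Z * p%:Z ^+ uphalf i) => //.
  by rewrite sd; apply/sqrt0_primeX_form; exists j; rewrite // subrr dvdz0.
split=> [[[_ [mu [d1 [lmu d_def obs]]]]|[]]|no_root].
- have mui : (mu.*2 < i)%N.
    by rewrite -lmu ltnNge -dvdz_primeX_logn //; apply: contraNneq pd => ->.
  case=> t; rewrite {1}d_def.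
  case/(sqrt_primeX_form _ _ _ _ (ltnW mui)) => sigma [j [s_lt ps j_lt tj]].
  rewrite (cong _ _ tj) => jb.
  by apply: (obs sigma j) => //; apply/eqmodz_dvd.
- by rewrite (negPf pd).
have [mu [d1 [lmu d_def mui]]] := residue_ndvd_logn _ _ pd res.
left; split; first exact/negP.
exists mu, d1; split=> // sigma j s_lt /eqmodz_dvd ps j_lt /eqmodz_dvd jb.
apply: no_root.
exists (sigma%:Z * p%:Z ^+ mu + j%:Z * p%:Z ^+ (i - mu)) => //.
rewrite d_def; apply/(sqrt_primeX_form _ _ _ _ (ltnW mui)).
by exists sigma, j; rewrite subrr dvdz0; split.
Qed.

(** * Roots of the quadratic and validity of IQF *)

(* Since (2 a x + b)^2 - d = 4 a (a x^2 + b x + c) and p^l exactly divides 4 a,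
   the existence of s in IQF amounts to a x^2 + b x + c = 0 mod p^(i - l). *)
Lemma IQF_validP (a a' b c : int) i l : odd p -> (l <= i)%N ->
  a = p%:Z ^+ l * a' -> ~~ (p%:Z %| a')%Z ->
  IQF_valid a b c (p%:Z ^+ i) <->
  forall x, (p%:Z ^+ (i - l) %| a * x ^+ 2 + b * x + c)%Z ->
            (p%:Z ^+ i %| a * x ^+ 2 + b * x + c)%Z.
Proof.
move=> p_odd li a_def pa'.
have key x : (p%:Z ^+ i %| (2 * a * x + b) ^+ 2 - (b ^+ 2 - 4 * a * c))%Z =
             (p%:Z ^+ (i - l) %| a * x ^+ 2 + b * x + c)%Z.
  have -> : (2 * a * x + b) ^+ 2 - (b ^+ 2 - 4 * a * c) =
    p%:Z ^+ l * (2 ^+ 2 * a' * (a * x ^+ 2 + b * x + c)) by rewrite a_def; ring.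
  rewrite -{1}(subnKC li) dvdz_primeXD Gauss_dvdzr //.
  by rewrite coprimezXl // primez_coprime dvdz_primeM negb_or odd_prime_ndvdz2X.
have ex x : (exists s : int, (s ^+ 2 = b ^+ 2 - 4 * a * c %[mod p%:Z ^+ i])%Z /\
                             (2 * a * x = - b + s %[mod p%:Z ^+ i])%Z) <->
            (p%:Z ^+ (i - l) %| a * x ^+ 2 + b * x + c)%Z.
  rewrite -key; split=> [[s [/eqmodz_dvd sd /eqmodz_dvd sx]]|xd].
    have -> : (2 * a * x + b) ^+ 2 - (b ^+ 2 - 4 * a * c) =
      (2 * a * x + b + s) * (2 * a * x - (- b + s))
      + (s ^+ 2 - (b ^+ 2 - 4 * a * c)) by ring.
    by rewrite dvdz_addr // dvdz_mull.
  exists (2 * a * x + b); split; first exact/eqmodz_dvd.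
  by congr (_ %% _)%Z; ring.
have weak x : (p%:Z ^+ i %| x)%Z -> (p%:Z ^+ (i - l) %| x)%Z.
  by apply: dvdz_trans; rewrite dvdz_exp2l ?leq_subr.
split=> [valid x /ex xd|lift x].
  by have /eqmodz_dvd := (valid x).2 xd; rewrite subr0.
rewrite ex; split=> [/eqmodz_dvd|/lift xi].
  by rewrite subr0 => /weak.
by apply/eqmodz_dvd; rewrite subr0.
Qed.

(** A root x gives s = 2 a x + b. Conversely, for s = b + p^l t, solving 2 a' x = t modulo p^(i - l)
    makes 2 a x + b = s modulo p^i. *)
Lemma quadratic_root_sqrtP (a a' b c : int) i l : odd p -> (l <= i)%N ->
  a = p%:Z ^+ l * a' -> ~~ (p%:Z %| a')%Z ->
  (exists x, (p%:Z ^+ (i - l) %| a * x ^+ 2 + b * x + c)%Z) <->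
  exists2 s, (p%:Z ^+ i %| s ^+ 2 - (b ^+ 2 - 4 * a * c))%Z
           & (p%:Z ^+ l %| s - b)%Z.
Proof.
move=> p_odd li a_def pa'.
have p4a' : ~~ (p%:Z %| 2 ^+ 2 * a')%Z.
  by rewrite dvdz_primeM negb_or odd_prime_ndvdz2X.
split=> [[x px]|[s sd /dvdzP[t s_def]]].
  exists (2 * a * x + b).
    have -> : (2 * a * x + b) ^+ 2 - (b ^+ 2 - 4 * a * c) =
      p%:Z ^+ l * (2 ^+ 2 * a' * (a * x ^+ 2 + b * x + c)).
      by rewrite a_def; ring.
    by rewrite -{1}(subnKC li) dvdz_primeXD dvdz_mull.
  by rewrite addrK a_def; apply/dvdzP; exists (2 * a' * x); ring.
have p2a' : ~~ (p%:Z %| 2 * a')%Z.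
  by rewrite dvdz_primeM negb_or (odd_prime_ndvdz2X 1).
have [x /dvdzP[k xt]] := primeX_linear_congruence _ t (i - l) p2a'.
exists x.
rewrite -(Gauss_dvdzr _ (m := p%:Z ^+ (i - l)) (n := 2 ^+ 2 * a')); last first.
  by rewrite coprimezXl // primez_coprime.
rewrite -(dvdz_primeXD l) subnKC //.
have -> : p%:Z ^+ l * (2 ^+ 2 * a' * (a * x ^+ 2 + b * x + c)) =
  (2 * a * x + b) ^+ 2 - (b ^+ 2 - 4 * a * c) by rewrite a_def; ring.
have sx : (p%:Z ^+ i %| 2 * a * x + b - s)%Z.
  have -> : 2 * a * x + b - s = p%:Z ^+ l * (2 * a' * x - t).
    by rewrite -[s](subrK b) s_def a_def; ring.
  by rewrite -{1}(subnKC li) dvdz_primeXD xt dvdz_mull.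
have -> : (2 * a * x + b) ^+ 2 - (b ^+ 2 - 4 * a * c) =
  (2 * a * x + b + s) * (2 * a * x + b - s)
  + (s ^+ 2 - (b ^+ 2 - 4 * a * c)) by ring.
by rewrite dvdz_addr // dvdz_mull.
Qed.

(* Hensel lifting: modulo p the polynomial is linear with unit slope b. *)
Lemma quadratic_root_of_unit_slope (a b c : int) n :
  (p%:Z %| a)%Z -> ~~ (p%:Z %| b)%Z ->
  exists x, (p%:Z ^+ n %| a * x ^+ 2 + b * x + c)%Z.
Proof.
move=> pa pb; elim: n => [|n [x /dvdzP[m xm]]]; first by exists 0; rewrite dvd1z.
(* With f(x) = m p^n, the correction t solves b t = -m modulo p. *)
have [t pt] := primeX_linear_congruence b (- m) 1 pb.
exists (x + p%:Z ^+ n * t).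
have -> : a * (x + p%:Z ^+ n * t) ^+ 2 + b * (x + p%:Z ^+ n * t) + c =
  p%:Z ^+ n * ((2 * x * t + p%:Z ^+ n * t ^+ 2) * a + (b * t - - m)).
  have -> : a * (x + p%:Z ^+ n * t) ^+ 2 + b * (x + p%:Z ^+ n * t) + c =
    (a * x ^+ 2 + b * x + c) + p%:Z ^+ n * (t * (2 * a * x + b))
    + a * (p%:Z ^+ n * t) ^+ 2 by ring.
  by rewrite xm; ring.
by rewrite -(addn1 n) dvdz_primeXD expr1 dvdz_addr // dvdz_mull.
Qed.

(* Compare the root x with x + p^k and x - p^k, for the least k such that these
   are still roots modulo p^(i - l). *)
Lemma lifting_roots_form (a a' b c x : int) i l : odd p -> (0 < l < i)%N ->
  a = p%:Z ^+ l * a' -> ~~ (p%:Z %| a')%Z ->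
  (forall y, (p%:Z ^+ (i - l) %| a * y ^+ 2 + b * y + c)%Z ->
             (p%:Z ^+ i %| a * y ^+ 2 + b * y + c)%Z) ->
  (p%:Z ^+ (i - l) %| a * x ^+ 2 + b * x + c)%Z ->
  exists k, [/\ l = 1%N, i = k.*2.+1 & (p%:Z ^+ k.+1 %| 2 * a * x + b)%Z].
Proof.
move=> p_odd /andP[l_gt0 li] a_def pa' lift px; set s := 2 * a * x + b.
(* For e = 1 or -1, f(x + e p^k) - f(x) = e p^k s + a p^(2 k). The second conjunct reads i - l <= l
   + 2 k, so that p^(i - l) divides a p^(2 k). *)
pose good k := (p%:Z ^+ (i - l) %| p%:Z ^+ k * s)%Z && (i <= (l + k).*2)%N.
have good_lift k : good k -> (i <= l + k.*2)%N /\ (p%:Z ^+ i %| p%:Z ^+ k * s)%Z.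
  case/andP=> ks ik.
  have dvd_a n : (n <= l + k.*2)%N -> (p%:Z ^+ n %| a * p%:Z ^+ k.*2)%Z.
    move=> nlk; rewrite a_def mulrAC -exprD; apply: dvdz_mulr.
    exact: dvdz_exp2l.
  have shift e : e ^+ 2 = 1 -> (p%:Z ^+ i %| e * p%:Z ^+ k * s + a * p%:Z ^+ k.*2)%Z.
    move=> e2; have fE : a * (x + e * p%:Z ^+ k) ^+ 2 + b * (x + e * p%:Z ^+ k) + c =
      (a * x ^+ 2 + b * x + c) + (e * p%:Z ^+ k * s + a * p%:Z ^+ k.*2).
      have -> : p%:Z ^+ k.*2 = e ^+ 2 * (p%:Z ^+ k * p%:Z ^+ k).
        by rewrite -addnn exprD e2 mul1r.
      by rewrite /s; ring.
    rewrite -(dvdz_addr _ (a * x ^+ 2 + b * x + c)) ?lift // -fE; apply: lift.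
    rewrite fE dvdz_addr // -mulrA dvdz_addr; last exact: dvdz_mull.
    by apply: dvd_a; clear -ik; lia.
  have p1 := shift 1 (expr1n _ _); have pN1 := shift (- 1) (sqrr_sign _ 1).
  (* The two increments add up to 2 a p^(2 k), and p divides neither 2 nor a'. *)
  have i_le : (i <= l + k.*2)%N.
    rewrite -primez_dvd_exp -(Gauss_dvdzr _ (n := 2 * a')); last first.
      rewrite coprimezXl // primez_coprime dvdz_primeM negb_or pa' andbT.
      exact: (odd_prime_ndvdz2X 1).
    have := rpredD p1 pN1; congr (_ %| _)%Z; rewrite a_def exprD; ring.
  split=> //; move: p1; rewrite addrC dvdz_addr ?mul1r //.
  exact: dvd_a.
have : exists k, good k.
  exists i; rewrite /good dvdz_mulr ?dvdz_exp2l ?leq_subr //; lia.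
case/ex_minnP=> -[|k] /good_lift[ilk pk] k_min; first by lia.
(* Since p^i divides p^(k + 1) s and l >= 1, p^(i - l) divides p^k s; minimality thus refutes the
   second conjunct for k. *)
have : ~~ good k by apply/negP => /k_min; rewrite ltnn.
rewrite negb_and; have -> /= : (p%:Z ^+ (i - l) %| p%:Z ^+ k * s)%Z.
  rewrite -(dvdz_primeXD 1) expr1 mulrA -exprS.
  by apply: dvdz_trans pk; rewrite dvdz_exp2l //; clear -l_gt0 li; lia.
rewrite -ltnNge => lki.
(* The bounds 2 (l + k) < i <= l + 2 (k + 1) leave only l = 1 and i = 2 k + 3. *)
have [l1 i_def] : l = 1%N /\ i = (k.+1 + k.+2)%N.
  by clear -l_gt0 ilk lki; lia.
exists k.+1; split=> //; first by rewrite i_def -addnn addnS.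
by rewrite i_def dvdz_primeXD in pk.
Qed.

End PrimePowers.

(** * The criterion for an odd prime power *)

Theorem corollary6p2 (a b c d : int) (hd : d = b ^+ 2 - 4 * a * c)
  (p : nat) (p_prime : prime p) (p_odd : odd p)
  (i : nat) (i_ge2 : (2 <= i)%N)
  (l : nat) (l_ge1 : (1 <= l)%N) (l_lti : (l < i)%N)
  (hgcd : gcdz a (p%:Z ^+ i) = p%:Z ^+ l) :
  IQF_valid a b c (p%:Z ^+ i) <->
  quadratic_nonresidue d (p%:Z ^+ i) \/
  (quadratic_residue d (p%:Z ^+ i) /\
   exactly_one
     [/\ (1 < l)%N, (p %| b)%Z & obstruction p i l b d]
     [/\ l = 1%N, odd i, (p %| b)%Z, (p %| c)%Z & (p%:Z ^+ i.+1 %| d)%Z]).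
Proof.
have [a' a_def pa'] := gcdz_primeX_eq _ p_prime _ _ _ l_lti hgcd.
have li := ltnW l_lti.
have pa : (p%:Z %| a)%Z by rewrite a_def dvdz_mulr // dvdz_exp.
have rootP := quadratic_root_sqrtP _ p_prime _ _ b c _ _ p_odd li a_def pa'.
rewrite -hd in rootP.
rewrite (IQF_validP _ p_prime _ _ _ _ _ _ p_odd li a_def pa').
have disc x : d = (2 * a * x + b) ^+ 2 - 4 * a * (a * x ^+ 2 + b * x + c).
  by rewrite hd; ring.
have no_rootP : quadratic_residue d (p%:Z ^+ i) -> (p %| b)%Z ->
    ~ (exists x, (p%:Z ^+ (i - l) %| a * x ^+ 2 + b * x + c)%Z) ->
    (1 < l)%N /\ obstruction p i l b d.
  move=> res pb no_root; split; last first.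
    by apply/obstructionP => // root; apply/no_root/rootP.
  (* If l = 1, then p divides d and hence every square root t of d modulo p^i, so t = b modulo p
     yields a root. *)
  rewrite ltn_neqAle l_ge1 andbT; apply/eqP => l1; apply: no_root; apply/rootP.
  case: res => t /eqmodz_dvd td; exists t => //.
  have pd : (p%:Z %| d)%Z by rewrite hd rpredB ?dvdz_exp // dvdz_mulr // dvdz_mull.
  rewrite -l1 expr1 rpredB //.
  have : (p%:Z %| t ^+ 2)%Z.
    rewrite -[t ^+ 2](subrK d) rpredD //.
    by apply: dvdz_trans td; rewrite dvdz_exp //; clear -i_ge2; lia.
  by rewrite expr2 dvdz_primeM // orbb.
split=> [lift|].
  have [root|no_root] :=
    classic (exists x, (p%:Z ^+ (i - l) %| a * x ^+ 2 + b * x + c)%Z).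
  - have [x px] := root.
    have [k [l1 i_def ps]] := lifting_roots_form _ p_prime _ _ _ _ x _ _ p_odd
      (introT andP (conj l_ge1 l_lti)) a_def pa' lift px.
    have pb : (p %| b)%Z.
      have -> : b = (2 * a * x + b) - 2 * x * a by ring.
      by rewrite rpredB ?dvdz_mull //; apply: dvdz_trans ps; rewrite dvdz_exp.
    have pc : (p %| c)%Z.
      have -> : c = (a * x ^+ 2 + b * x + c) - (a * x ^+ 2 + b * x) by ring.
      rewrite rpredB //; last by rewrite rpredD // dvdz_mulr.
      by apply: dvdz_trans px; rewrite dvdz_exp // subn_gt0.
    have pd : (p%:Z ^+ i.+1 %| d)%Z.
      (* Here (2 a x + b)^2 is divisible by p^(2 (k + 1)) = p^(i + 1), and 4 a f(x) by p p^i. *)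
      rewrite (disc x) rpredB //.
        by rewrite dvdz_primeX_sqr // i_def -doubleS uphalf_double.
      rewrite (exprS _ i); apply: dvdz_mul; [exact: dvdz_mull | exact: lift].
    right; split.
      exists 0; apply/eqmodz_dvd; rewrite expr0n sub0r rpredN.
      by apply: dvdz_trans pd; rewrite dvdz_exp2l.
    right; split; first by rewrite l1 => -[].
    by split=> //; rewrite i_def /= odd_double.
  have [res|] := classic (quadratic_residue d (p%:Z ^+ i)); last by left.
  right; split=> //; left.
  have pb : (p %| b)%Z.
    apply/negPn/negP => pb; apply: no_root.
    exact: (quadratic_root_of_unit_slope _ p_prime).
  have [l_gt1 obs] := no_rootP res pb no_root.
  by split=> // -[l1]; rewrite l1 in l_gt1.
(* A non-residue or an obstruction excludes roots modulo p^(i - l), so only case (ii) needs work. *)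
case=> [nonres|[res]] => [x px|[[[_ _ obs] _]|[_ [l1 i_odd pb pc pd]]] x px].
- have [s sd _] := rootP.1 (ex_intro _ x px).
  by case: nonres; exists s; apply/eqmodz_dvd.
- have root := rootP.1 (ex_intro _ x px).
  by have := (obstructionP _ p_prime i l b d li res).1 obs root.
have p4f : (p%:Z ^+ i %| 4 * a * (a * x ^+ 2 + b * x + c))%Z.
  rewrite -{1}(subnKC li) exprD; apply: dvdz_mul => //.
  by rewrite a_def dvdz_mull // dvdz_mulr.
have ps : (p%:Z ^+ i.+1 %| (2 * a * x + b) ^+ 2)%Z.
  (* As i is odd, a square divisible by p^i is divisible by p^(i + 1). *)
  have half : uphalf i.+1 = uphalf i by clear -i_odd; lia.
  rewrite (dvdz_primeX_sqr _ p_prime) half -(dvdz_primeX_sqr _ p_prime).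
  rewrite -[X in (_ %| X)%Z](subrK (4 * a * (a * x ^+ 2 + b * x + c))) -disc.
  by rewrite rpredD //; apply: dvdz_trans pd; rewrite dvdz_exp2l.
rewrite -(Gauss_dvdzr _ (n := 2 ^+ 2 * a')); last first.
  rewrite coprimezXl // primez_coprime // dvdz_primeM // negb_or pa'.
  by rewrite odd_prime_ndvdz2X.
(* As a = p a', one factor p cancels from p^(i + 1) dividing 4 a f(x). *)
rewrite -(dvdz_primeXD _ p_prime 1) add1n.
have -> : p%:Z ^+ 1 * (2 ^+ 2 * a' * (a * x ^+ 2 + b * x + c)) =
  (2 * a * x + b) ^+ 2 - d by rewrite (disc x) [in 4 * a]a_def l1; ring.
by rewrite rpredB.
Qed.
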